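(* For any $d\in\mathbb{N}$ and any function $B:\mathbb{N}^d\to\mathbb{N}^d$ there exist functions $C_B=(C_{B,1},\ldots,C_{B,d}):\mathbb{N}^d\to\mathbb{N}^d$ and $h_B=(h_{B,1},\ldots,h_{B,d}):\mathbb{N}^d\to\mathbb{N}^d$, depending on $B$, such that the following holds. Let $\mathbb{K}$ be an algebraically closed field of characteristic $0$ and $S=\mathbb{K}[x_1,\ldots,x_N]$. Given a graded vector space $U=\bigoplus_{i=1}^dU_i\subset S$ with dimension sequence $\delta\in\mathbb{N}^d$, there exists a $B$-strong graded vector space $V=\bigoplus_{i=1}^dV_i\subset S$ such that (1) $\mathbb{K}[U]\subset\mathbb{K}[V]$; (2) $\dim(V_i)\le C_{B,i}(\delta)$ for all $i\in\{1,\ldots,d\}$. Furthermore, suppose $H=\bigoplus_{i=1}^dH_i\subset U$ is a graded subspace such that $s_{\min}(H_i)\ge h_{B,i}(\delta)$ for all $i\in\{1,\ldots,d\}$. Then there exists a $B$-strong graded vector space $V$ satisfying (1) and (2) such that $H\subset V$.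
   Context: A form is a homogeneous polynomial. $\mathbb{K}[V]$ is the $\mathbb{K}$-subalgebra of $S$ generated by $V$. The dimension sequence of $V=\bigoplus_{i=1}^dV_i$ (with $V_i\subset S_i$ finite dimensional) is $(\dim V_1,\ldots,\dim V_d)$. A nonzero form $F\in S_d$ has a $k$-collapse if there are $k$ forms $G_1,\ldots,G_k$ with $1\le\deg(G_i)<d$ and $F\in(G_1,\ldots,G_k)$. The strength $s(F)$ is the integer such that $F$ has an $(s(F)+1)$-collapse but no $s(F)$-collapse; nonzero linear forms have strength $\infty$. $s_{\min}(V)$ is the minimum strength of a nonzero element of $V\subset S_d$, with $s_{\min}((0))=\infty$. $V$ is $B$-strong if $s_{\min}(V_i)\ge B_i(\delta)$ for all $i$, where $\delta$ is the dimension sequence of $V$. *)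

(* Defs.v *)
From HB Require Import structures.
From mathcomp Require Import all_boot all_order all_algebra.
From mathcomp Require Import mpoly.

Set Implicit Arguments.
Unset Strict Implicit.
Unset Printing Implicit Defensive.

Import GRing.Theory.
Local Open Scope ring_scope.

(* S_d for S = K[x_1, ..., x_N].  The library declares [dhomog n.+1 K d] to be *)
(* a vectType; this copy is a vectType for every number N >= 0 of variables.   *)
Definition hform (N : nat) (K : fieldType) (d : nat) : Type := dhomog N K d.

HB.instance Definition _ (N : nat) (K : fieldType) (d : nat) :=
  GRing.Lmodule.copy (hform N K d) (dhomog N K d).

Definition hform_dim (N d : nat) : nat :=
  if N is n.+1 then 'C(d + n, d) else d == 0%N.

Lemma hform_vecaxiom (N : nat) (K : fieldType) (d : nat) :
  Vector.axiom (hform_dim N d) (hform N K d).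
Proof.
case: N => [|n]; last exact: dhomog_vecaxiom.
have m0 (m : 'X_{1..0}) : m = 0%MM by apply/mnmP; case.
exists (fun p : hform 0 K d => \row_j (val p)@_0%MM).
  by move=> c p q; apply/rowP => j; rewrite !mxE /= mcoeffD mcoeffZ.
case: d => [|d].
  have hC (c : K) : c%:MP_[0] \is 0.-homog.
    by rewrite -[c%:MP]mulr1 mul_mpolyC; apply/dhomogZ/dhomog1.
  exists (fun r : 'rV[K]_(hform_dim 0 0) => DHomog (hC (r 0 0))).
    move=> p; apply/val_inj/mpolyP => m /=.
    by rewrite (m0 m) mxE mcoeffC eqxx mulr1.
  by move=> r; apply/rowP => j; rewrite mxE /= mcoeffC eqxx mulr1 (ord1 j).
exists (fun=> 0 : hform 0 K d.+1) => [p|r]; last by apply/rowP; case.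
apply/val_inj/mpolyP => m /=; rewrite mcoeff0; apply/esym.
apply: (dhomog_nemf_coeff (dhomog_is_dhomog p)).
by rewrite (m0 m) /= mdeg0.
Qed.

HB.instance Definition _ (N : nat) (K : fieldType) (d : nat) :=
  Lmodule_hasFinDim.Build K (hform N K d) (hform_vecaxiom N K d).

Section Strength.
Variables (N : nat) (K : fieldType).

Definition in_ideal (k : nat) (G : 'I_k -> {mpoly K[N]}) (F : {mpoly K[N]}) :=
  exists A : 'I_k -> {mpoly K[N]}, F = \sum_(i < k) A i * G i.

Definition has_collapse (d k : nat) (F : hform N K d) : Prop :=
  exists G : 'I_k -> {mpoly K[N]},
    (forall i, exists e : nat,
        [/\ (1 <= e < d)%N, G i != 0 & G i \is e.-homog])
    /\ in_ideal G (val F).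

(* Extended naturals: [None] stands for infinity. *)
Definition enat_le (m n : option nat) : Prop :=
  match m, n with
  | _, None => True
  | None, Some _ => False
  | Some a, Some b => (a <= b)%N
  end.

(* Only meaningful for F != 0. *)
Definition is_strength (d : nat) (F : hform N K d) (s : option nat) : Prop :=
  match s with
  | Some k => has_collapse k.+1 F /\ ~ has_collapse k F
  | None => d = 1%N
  end.

Definition is_smin (d : nat) (V : {vspace hform N K d}) (m : option nat) : Prop :=
  if V == 0%VS then m = None
  else (exists F : hform N K d, [/\ F \in V, F != 0 & is_strength F m])
       /\ (forall (F : hform N K d) (s : option nat),
             F \in V -> F != 0 -> is_strength F s -> enat_le m s).

Definition smin_ge (d : nat) (V : {vspace hform N K d}) (b : nat) : Prop :=
  exists2 m : option nat, is_smin V m & enat_le (Some b) m.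

End Strength.

Section Graded.
Variables (N : nat) (K : fieldType) (d : nat).

(* The component of index i : 'I_d sits in degree i + 1. *)
Definition graded : Type := forall i : 'I_d, {vspace hform N K i.+1}.

Definition dimseq (V : graded) : {ffun 'I_d -> nat} := [ffun i => \dim (V i)].

Definition graded_sub (U V : graded) : Prop := forall i, (U i <= V i)%VS.

Definition in_graded (V : graded) (f : {mpoly K[N]}) : Prop :=
  exists v : forall i : 'I_d, hform N K i.+1,
    (forall i, v i \in V i) /\ f = \sum_(i < d) val (v i).

Inductive subalg_gen (X : {mpoly K[N]} -> Prop) : {mpoly K[N]} -> Prop :=
  | subalg_gen_in f of X f : subalg_gen X f
  | subalg_gen_const (c : K) : subalg_gen X c%:MP
  | subalg_gen_add f g of subalg_gen X f & subalg_gen X g : subalg_gen X (f + g)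
  | subalg_gen_mul f g of subalg_gen X f & subalg_gen X g : subalg_gen X (f * g).

Definition alg_of (V : graded) : {mpoly K[N]} -> Prop :=
  subalg_gen (in_graded V).

Definition strong (B : {ffun 'I_d -> nat} -> {ffun 'I_d -> nat}) (V : graded) :=
  forall i, smin_ge (V i) (B (dimseq V) i).

End Graded.

(* Main.v *)
(* If U is not B-strong, some nonzero F in U_i is a sum of k = B_i(delta)      *)
(* products A_j G_j of forms of smaller degree.  Replace U_i by a hyperplane   *)
(* missing F and add the A_j and G_j in degrees below i.  The algebra only     *)
(* grows, and the dimension sequence, read from the top degree, decreases      *)
(* lexicographically while each entry grows by at most 2k: the process stops   *)
(* after finitely many steps, with bounds depending on delta and B alone.  If  *)
(* H_i has no element with a k-collapse, then F is not in H_i and the          *)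
(* hyperplane can be chosen to contain H_i.                                    *)

Require Import Defs.
From HB Require Import structures.
From mathcomp Require Import all_boot all_order all_algebra.
From mathcomp Require Import mpoly.
From Stdlib Require Import Classical ClassicalEpsilon.

Set Implicit Arguments.
Unset Strict Implicit.
Unset Printing Implicit Defensive.

Import GRing.Theory.
Local Open Scope ring_scope.

(** The descent runs on the dimension sequence [δ] rather than on one space. [collapse_step]
    performs a single replacement: the components below the modified degree may grow, but its own
    dimension drops and the higher ones stay fixed. [lex_ind] makes this terminate, and
    [strengthening_exists] takes maxima over all sequences a step can reach, so the bounds are
    uniform in the field and in the number of variables. Throughout, [smin_geP] replaces strength by
    the absence of collapses. *)

Lemma nat_least (P : nat -> Prop) :
  (exists n, P n) -> exists2 n, P n & forall m, P m -> (n <= m)%N.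
Proof.
case=> n; elim/ltn_ind: n => n IHn Pn.
case: (classic (exists2 m, P m & (m < n)%N)) => [[m Pm lt_mn] | noP].
  exact: (IHn m).
exists n => // m Pm; rewrite leqNgt; apply/negP => lt_mn.
by apply: noP; exists m.
Qed.

(** Take [W] to be [H] plus a complement in [U] of [X = H + <v>]. If [v] were in [W], its component
    in the complement would also lie in [X], hence vanish, putting [v] in [H]. *)
Lemma vspace_hyperplane (K : fieldType) (vT : vectType K)
    (H U : {vspace vT}) (v : vT) :
  (H <= U)%VS -> v \in U -> v \notin H ->
  exists W : {vspace vT},
    [/\ (H <= W)%VS, (W + <[v]>)%VS = U & (\dim W < \dim U)%N].
Proof.
move=> sHU Uv Hv; set X := (H + <[v]>)%VS.
have sXU : (X <= U)%VS by rewrite subv_add sHU -memvE.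
have sWU : (H + (U :\: X) <= U)%VS by rewrite subv_add sHU diffvSl.
exists (H + (U :\: X))%VS; split; first exact: addvSl.
  by rewrite [(H + _)%VS]addvC -addvA addv_diff; apply/addv_idPl.
rewrite (ltn_leqif (dimv_leqif_sup sWU)); apply: contra Hv => /subvP/(_ _ Uv).
case/memv_addP=> h Hh [w Ww def_v].
have : w \in ((U :\: X) :&: X)%VS.
  rewrite memv_cap Ww -[w](addKr h) -def_v addrC memvB //.
    exact: (subvP (addvSr _ _)) (memv_line _).
  exact: (subvP (addvSl _ _)).
by rewrite capv_diff memv0 => /eqP w0; rewrite def_v w0 addr0.
Qed.

(** * Well-founded induction on dimension sequences, top degree first *)

Section LexInduction.
Variable d : nat.
Implicit Types f g : {ffun 'I_d -> nat}.

Definition lex_lt f g :=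
  [exists i, (f i < g i)%N && [forall j : 'I_d, (i < j)%N ==> (f j == g j)]].

Lemma lex_ind (Q : {ffun 'I_d -> nat} -> Prop) :
  (forall g, (forall f, lex_lt f g -> Q f) -> Q g) -> forall g, Q g.
Proof.
move=> IH.
(* Only drops at an index at least [m] are assumed settled: [below 0 g] is the full induction
   hypothesis, and [below d g] is vacuous. *)
pose below m g := forall f (i : 'I_d), (m <= i)%N -> (f i < g i)%N ->
  (forall j : 'I_d, (i < j)%N -> f j = g j) -> Q f.
suff Qbelow m : (m <= d)%N -> forall g, below m g -> Q g.
  by move=> g; apply: (Qbelow d) => // f i; rewrite leqNgt ltn_ord.
elim: m => [_ g Qg | m IHm lt_md g].
  apply: IH => f /existsP[i /andP[lt_fg /forallP eq_fg]].
  by apply: (Qg f i) => // j lt_ij; apply/eqP; apply: (implyP (eq_fg j)).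
pose im := Ordinal lt_md.
(* A drop exactly at [m] is absorbed by induction on the entry there; the entries above [m] are
   unchanged, so [below m.+1] passes to the smaller sequence. *)
have [n] := ubnP (g im); elim: n g => // n IHn g; rewrite ltnS => le_gn Qg.
apply: IHm (ltnW lt_md) _ _ => f i; rewrite leq_eqVlt => /predU1P[mi | lt_mi].
  have -> : i = im by apply: val_inj.
  move=> lt_fg eq_fg; apply: IHn => [|f' j lt_mj lt_f'f eq_f'f].
    exact: leq_trans lt_fg le_gn.
  apply: (Qg f' j) => // [|j' lt_jj']; first by rewrite -eq_fg.
  by rewrite eq_f'f // eq_fg //; apply: ltn_trans lt_jj'.
exact: Qg.
Qed.

End LexInduction.

(** * Strength in terms of collapses *)

Section Collapse.
Variables (N : nat) (K : fieldType).

Lemma has_collapse0 d (F : hform N K d) : has_collapse 0 F -> F = 0.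
Proof.
by case=> G [_ [A defF]]; apply/val_inj; rewrite /= defF big_ord0.
Qed.

Lemma has_collapse_leq d (F : hform N K d) k k' :
  F != 0 -> (k <= k')%N -> has_collapse k F -> has_collapse k' F.
Proof.
case: k => [|k] nzF le_kk'; first by move/has_collapse0/eqP; rewrite (negPf nzF).
case=> G [homG [A defF]].
(* The added forms must be nonzero of admissible degree, so a member of [G] is repeated, with
   coefficient 0. *)
exists (fun i : 'I_k' => G (inord i)); split=> [i|]; first exact: homG.
exists (fun i : 'I_k' => if (i < k.+1)%N then A (inord i) else 0).
under eq_bigr do rewrite (fun_if (fun a => a * _)) mul0r.
rewrite -big_mkcond -(big_ord_widen k' (fun i => A (inord i) * G (inord i))) //.
by rewrite defF; apply: eq_bigr => i _; rewrite inord_val.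
Qed.

(** The variables themselves give a collapse: each monomial of positive degree is divisible by one
    of them, and [1 < d] makes degree 1 admissible. *)
Lemma has_collapse_exists d (F : hform N K d) :
  (1 < d)%N -> exists k, has_collapse k F.
Proof.
case: F => f homf d_gt1; exists N, (fun i => 'X_i); split=> [i|].
  exists 1%N; split=> //; first by rewrite -msupp_eq0 msuppX.
  by rewrite dhomogX; apply/eqP/mdeg1.
rewrite /in_ideal /= [f]mpolyE big_seq; elim/big_ind: _ => [|g g'|m].
- by exists (fun=> 0); rewrite big1 // => i _; rewrite mul0r.
- move=> [A ->] [A' ->]; exists (fun i => A i + A' i).
  by rewrite -big_split; apply: eq_bigr => i _; rewrite mulrDl.
move=> /(dhomog_mf homf) /= deg_m.
have /existsP[i nz_mi] : [exists i, m i != 0%N].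
  apply: contraLR d_gt1 => /existsPn m0; rewrite -deg_m mdegE big1 // => i _.
  by apply/eqP/negPn.
exists (fun j => if j == i then f@_m *: 'X_[m - U_(i)] else 0).
rewrite (bigD1 i) //= eqxx big1 => [|j /negPf->]; last by rewrite mul0r.
by rewrite addr0 -scalerAl -mpolyXD submK // lep1mP.
Qed.

Lemma strength_exists d (F : hform N K d) :
  (0 < d)%N -> F != 0 -> exists s, is_strength F s.
Proof.
case: d F => [//|[|d]] F _ nzF; first by exists None.
have /nat_least[[|k] colF minF] := has_collapse_exists F isT.
  by move: nzF; rewrite (has_collapse0 colF) eqxx.
by exists (Some k); split=> // /minF; rewrite ltnn.
Qed.

Lemma no_collapse_linear (F : hform N K 1) k : F != 0 -> ~ has_collapse k F.
Proof.
case: k => [|k] nzF; first by move/has_collapse0/eqP; rewrite (negPf nzF).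
by case=> G [/(_ ord0)[[|e] []]].
Qed.

Definition collapse_free d (V : {vspace hform N K d}) b :=
  forall F, F \in V -> F != 0 -> ~ has_collapse b F.

Lemma collapse_free_leq d (V : {vspace hform N K d}) a b :
  (a <= b)%N -> collapse_free V b -> collapse_free V a.
Proof.
by move=> le_ab freeV F VF nzF /(has_collapse_leq nzF le_ab); apply: freeV.
Qed.

(** Collapses persist when [k] grows, so strength at least [b] means no [b]-collapse. Nonzero linear
    forms have no collapse at all, which matches their infinite strength. *)
Lemma smin_geP d (V : {vspace hform N K d.+1}) b :
  smin_ge V b <-> collapse_free V b.
Proof.
split=> [[m minV le_bm] F VF nzF colF | freeV].
  move: minV; rewrite /is_smin; case: eqP => [V0 _ | _ [_ minV]].
    by move: VF; rewrite V0 memv0 (negPf nzF).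
  have [s strF] := strength_exists (ltn0Sn _) nzF.
  have := minV _ _ VF nzF strF; case: s strF => [s [_ noF] | d1].
    case: m {minV} le_bm => // m le_bm le_ms.
    by apply: noF; apply: has_collapse_leq colF; rewrite ?(leq_trans le_bm).
  case: d1 => d0; move: F nzF colF {VF}; rewrite d0 => F nzF colF _.
  exact: (no_collapse_linear nzF colF).
case: (eqVneq V 0%VS) => [V0 | nzV].
  by exists None => //; rewrite /is_smin V0 eqxx.
have [F VF nzF] : exists2 F, F \in V & F != 0.
  by exists (vpick V); rewrite ?memv_pick ?vpick0.
case: d V freeV nzV F VF nzF => [|d] V freeV nzV F VF nzF.
  exists None => //; rewrite /is_smin (negPf nzV); split; first by exists F.
  by move=> F' [s|//] _ nzF' [/(no_collapse_linear nzF')].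
have /nat_least[s [F' [VF' nzF' strF']] min_s] : exists s, exists F',
    [/\ F' \in V, F' != 0 & is_strength F' (Some s)].
  by have [[s|//] strF] := strength_exists (ltn0Sn _) nzF; exists s, F.
exists (Some s).
  rewrite /is_smin (negPf nzV); split; first by exists F'.
  by move=> F1 [t|//] VF1 nzF1 strF1; apply: min_s; exists F1.
case: strF' => colF' _; rewrite /= leqNgt; apply/negP => lt_sb.
exact: freeV VF' nzF' (has_collapse_leq nzF' lt_sb colF').
Qed.

End Collapse.

(** * Generated subalgebras and one step of the descent *)

Section GradedAlgebra.
Variables (N : nat) (K : fieldType) (d : nat).
Implicit Types U V H : graded N K d.

Definition homog_part e (f : {mpoly K[N]}) : hform N K e :=
  DHomog (pihomogP mdeg e f).

(** Multiplication by [G] shifts each homogeneous part of [A] by exactly [e] degrees, so a single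
    part reaches degree [c]. *)
Lemma pihomogMr e c (A G : {mpoly K[N]}) :
  G \is e.-homog -> (e <= c)%N ->
  pihomog mdeg c (A * G) = pihomog mdeg (c - e) A * G.
Proof.
move=> homG le_ec.
rewrite [in LHS](pihomog_partitionE (leqnn (mmeasure mdeg A))).
rewrite mulr_suml raddf_sum /=.
have homAG a : pihomog mdeg a A * G \is (a + e).-homog.
  by apply: dhomogM => //; apply: pihomogP.
have [lt_ca | le_ac] := ltnP (c - e) (mmeasure mdeg A).
  rewrite (bigD1 (Ordinal lt_ca)) //= big1 ?addr0 => [|a ne_a].
    by apply: pihomog_dE; have := homAG (c - e)%N; rewrite subnK.
  apply: (pihomog_ne0 _ (homAG a)); apply: contra ne_a => /eqP ae.
  by rewrite -val_eqE /= -ae addnK.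
(* Here [c - e] exceeds every degree occurring in [A], and both sides vanish. *)
rewrite big1 => [|a _].
  rewrite pihomogE big_seq_cond big1 ?mul0r // => m /andP[Am /eqP deg_m].
  by have := mmeasure_mnm_lt mdeg Am; rewrite ltnNge deg_m le_ac.
apply: (pihomog_ne0 _ (homAG a)).
by apply: contraTneq (ltn_ord a) => ae; rewrite -leqNgt -[a : nat](addnK e) ae.
Qed.

Lemma alg_of_mem V (i : 'I_d) (F : hform N K i.+1) : F \in V i -> alg_of V (val F).
Proof.
move=> VF; apply: subalg_gen_in.
pose v (j : 'I_d) : hform N K j.+1 :=
  dfwith (fun j : 'I_d => 0 : hform N K j.+1) (i := i) F j.
exists v; split=> [j|].
  by rewrite /v; case: dfwithP => // k _; apply: mem0v.
rewrite (bigD1 i) //= big1 => [|j ne_ji].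
  by rewrite addr0 /v dfwith_in.
by rewrite /v dfwith_out // eq_sym.
Qed.

Lemma alg_of_sum V I (r : seq I) (P : pred I) (F : I -> {mpoly K[N]}) :
  (forall i, P i -> alg_of V (F i)) -> alg_of V (\sum_(i <- r | P i) F i).
Proof.
move=> VF; elim/big_ind: _ => //; last exact: subalg_gen_add.
by rewrite -[0]mpolyC0; apply: subalg_gen_const.
Qed.

Lemma alg_of_sub U V :
  (forall (i : 'I_d) (F : hform N K i.+1), F \in U i -> alg_of V (val F)) ->
  forall f, alg_of U f -> alg_of V f.
Proof.
move=> UV f; elim=> [{}f [v [Uv ->]] | c | f1 f2 _ V1 _ V2 | f1 f2 _ V1 _ V2].
- by apply: alg_of_sum => i _; apply: UV.
- exact: subalg_gen_const.
- exact: subalg_gen_add.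
- exact: subalg_gen_mul.
Qed.

Lemma collapse_step U H (i : 'I_d) k (F : hform N K i.+1) :
  graded_sub H U -> F \in U i -> F \notin H i -> has_collapse k F ->
  exists U' : graded N K d,
    [/\ graded_sub H U',
        forall f, alg_of U f -> alg_of U' f,
        (\dim (U' i) < \dim (U i))%N,
        forall j : 'I_d, (i < j)%N -> \dim (U' j) = \dim (U j)
      & forall j, (\dim (U' j) <= \dim (U j) + (k + k))%N].
Proof.
move=> sHU UF HF [G [homG [A defF]]].
have [W [sHW defU lt_WU]] := vspace_hyperplane (sHU i) UF HF.
pose U0 (j : 'I_d) : {vspace hform N K j.+1} := dfwith U W j.
(* The cofactors [A t] need not be homogeneous, so every part of degree at most [i] is added; [F]
   itself has degree [i.+1]. This costs at most [k + k] generators per degree. *)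
pose X (j : 'I_d) : seq (hform N K j.+1) :=
  if (j < i)%N then [seq homog_part j.+1 (G t) | t : 'I_k]
                    ++ [seq homog_part j.+1 (A t) | t : 'I_k] else [::].
exists (fun j => U0 j + <<X j>>)%VS.
have U0i : U0 i = W by rewrite /U0 dfwith_in.
have U0j j : j != i -> U0 j = U j by move=> ne_ji; rewrite /U0 dfwith_out // eq_sym.
have X0 (j : 'I_d) : (i <= j)%N -> (U0 j + <<X j>>)%VS = U0 j.
  by rewrite leqNgt /X => /negPf->; rewrite span_nil addv0.
have U'X (j : 'I_d) (f : {mpoly K[N]}) :
    homog_part j.+1 f \in X j ->
    alg_of (fun j => U0 j + <<X j>>)%VS (pihomog mdeg j.+1 f).
  move=> Xf; apply: (@alg_of_mem _ j (homog_part j.+1 f)).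
  by apply: (subvP (addvSr _ _)); apply: memv_span.
have U'F : alg_of (fun j => U0 j + <<X j>>)%VS (val F).
  (* Taking parts of degree [i.+1] makes the cofactors homogeneous: [G t] sits at index [e.-1], and
     the relevant part of [A t] at index [i - e], both below [i]. *)
  rewrite -(pihomog_dE (dhomog_is_dhomog F)) defF raddf_sum /=.
  apply: alg_of_sum => t _; have [e [/andP[e_gt0 lt_ei] _ homGt]] := homG t.
  rewrite (pihomogMr _ homGt (ltnW lt_ei)).
  have lt_i : (i < d)%N := ltn_ord i.
  have lt_e : (e.-1 < d)%N by rewrite prednK // (leq_trans _ lt_i) // ltnW.
  have lt_c : (i - e < d)%N by rewrite (leq_ltn_trans (leq_subr _ _)).
  apply: subalg_gen_mul.
    rewrite subSn //; apply: (U'X (Ordinal lt_c)).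
    rewrite /X /= ltn_subrL e_gt0 (leq_trans e_gt0) // mem_cat.
    by rewrite [X in _ || X]map_f ?orbT ?mem_enum.
  rewrite -(pihomog_dE homGt) -[e in pihomog _ e _](prednK e_gt0).
  apply: (U'X (Ordinal lt_e)).
  by rewrite /X /= ifT ?mem_cat ?[X in X || _]map_f ?mem_enum // prednK.
split=> [j|||j lt_ij|j].
- apply: subv_trans (addvSl _ _); case: (eqVneq j i) => [->|/U0j->//].
  by rewrite U0i.
- apply: alg_of_sub => j f; case: (eqVneq j i) => [->|ne_ji] in f * => Uf.
    move: Uf; rewrite -defU => /memv_addP[w Ww [_ /vlineP[c ->] ->]].
    apply: subalg_gen_add.
      by apply: (@alg_of_mem _ i w); rewrite X0 // U0i.
    rewrite /= -mul_mpolyC; apply: subalg_gen_mul U'F.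
    exact: subalg_gen_const.
  apply: (@alg_of_mem _ j f); apply: (subvP (addvSl _ _)).
  by rewrite U0j.
- by rewrite X0 // U0i.
- by rewrite X0 ?(ltnW lt_ij) // U0j // -val_eqE /= gtn_eqF.
apply: leq_trans (dimv_add_leqif _ _) _; apply: leq_add.
  by case: (eqVneq j i) => [->|/U0j->//]; rewrite U0i ltnW.
apply: leq_trans (dim_span _) _; rewrite /X; case: ifP => // _.
by rewrite size_cat !size_map -enumT size_enum_ord.
Qed.

End GradedAlgebra.

(** * Bounds depending only on the dimension sequence *)

(** The pair [p] holds the values at [δ] of [C] and [h]; it is fixed before the field, [N] and the
    spaces. *)
Definition strengthening d (B : {ffun 'I_d -> nat} -> {ffun 'I_d -> nat})
    (δ : {ffun 'I_d -> nat}) (p : {ffun 'I_d -> nat} * {ffun 'I_d -> nat}) :=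
  forall (K : fieldType) (N : nat) (U H : graded N K d),
    dimseq U = δ -> graded_sub H U ->
    (forall i, collapse_free (H i) (p.2 i)) ->
    exists V : graded N K d,
      [/\ strong B V,
          forall f, alg_of U f -> alg_of V f,
          forall i, (\dim (V i) <= p.1 i)%N
        & graded_sub H V].

(* The dimension sequences reached from δ by one step lie in the finite set of *)
(* those that are lexicographically smaller and bounded by M, hence the maxima *)
(* below; dominating the thresholds of all of them keeps H intact throughout.  *)
Lemma strengthening_exists d (B : {ffun 'I_d -> nat} -> {ffun 'I_d -> nat}) δ :
  exists p, strengthening B δ p.
Proof.
elim/lex_ind: δ => δ IH.
(* A step at index [i] uses [k = B δ i], so no resulting entry exceeds [M], whichever [i] occurs. *)
pose M := (\max_i δ i + \max_i (B δ i + B δ i))%N.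
pose nat_of (t : {ffun 'I_d -> 'I_M.+1}) : {ffun 'I_d -> nat} := [ffun i => val (t i)].
have /fin_all_exists[p pP] : forall t, exists p,
    lex_lt (nat_of t) δ -> strengthening B (nat_of t) p.
  move=> t; case: (boolP (lex_lt (nat_of t) δ)) => [/IH[p] | _]; first by exists p.
  by exists ([ffun=> 0%N], [ffun=> 0%N]).
(* The entries [δ i] serve the case where [U] is already strong; [B δ i] keeps the collapsing form
   of the first step out of [H]. *)
exists ([ffun i => maxn (δ i) (\max_t (p t).1 i)],
        [ffun i => maxn (B δ i) (\max_t (p t).2 i)]).
move=> K N U H dimU sHU freeH.
have freeHB i : collapse_free (H i) (B δ i).
  by apply: collapse_free_leq (freeH i); rewrite ffunE leq_maxl.
case: (classic (strong B U)) => [strU | /not_all_ex_not[i /smin_geP notfree]].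
  by exists U; split=> // i; rewrite ffunE -dimU ffunE leq_maxl.
have [F [UF nzF colF]] :
    exists F, [/\ F \in U i, F != 0 & has_collapse (B δ i) F].
  apply: NNPP => noF; apply: notfree; rewrite dimU => F UF nzF colF.
  by apply: noF; exists F.
have HF : F \notin H i by apply/negP => /freeHB/(_ nzF).
have [U' [sHU' UU' dim_i dim_gt dim_le]] := collapse_step sHU UF HF colF.
have dimM j : (\dim (U' j) < M.+1)%N.
  rewrite ltnS; apply: leq_trans (dim_le j) _; apply: leq_add.
    by rewrite -[\dim _](ffunE (fun j => \dim (U j))) -/(dimseq U) dimU leq_bigmax.
  exact: (leq_bigmax_cond (F := fun i => B δ i + B δ i)%N).
pose t : {ffun 'I_d -> 'I_M.+1} := [ffun j => Ordinal (dimM j)].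
have dimU' : dimseq U' = nat_of t by apply/ffunP => j; rewrite !ffunE.
have lt_t : lex_lt (nat_of t) δ.
  rewrite -dimU' -dimU; apply/existsP; exists i; rewrite !ffunE dim_i /=.
  by apply/forallP => j; apply/implyP => /dim_gt; rewrite !ffunE => ->.
have [|V [strV U'V dimV sHV]] := pP t lt_t K N U' H dimU' sHU'.
  move=> j; apply: collapse_free_leq (freeH j); rewrite ffunE.
  by rewrite leq_max (leq_bigmax (F := fun t => (p t).2 j)) orbT.
exists V; split=> // [f /UU'/U'V // | j]; rewrite ffunE leq_max.
apply/orP; right; apply: leq_trans (dimV j) _.
exact: (leq_bigmax (F := fun t => (p t).1 j)).
Qed.

Local Close Scope ring_scope.

Theorem lemma5p15 (d : nat)
    (B : {ffun 'I_d -> nat} -> {ffun 'I_d -> nat}) :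
  exists C h : {ffun 'I_d -> nat} -> {ffun 'I_d -> nat},
  forall (K : closedFieldType) (N : nat) (U : graded N K d),
    ([pchar K] =i pred0)%R ->
    (exists V : graded N K d,
      [/\ strong B V,
          forall f, alg_of U f -> alg_of V f
        & forall i, \dim (V i) <= C (dimseq U) i])
    /\
    (forall H : graded N K d,
      graded_sub H U ->
      (forall i, smin_ge (H i) (h (dimseq U) i)) ->
      exists V : graded N K d,
        [/\ strong B V,
            forall f, alg_of U f -> alg_of V f,
            forall i, \dim (V i) <= C (dimseq U) i
          & graded_sub H V]).
Proof.
pose p δ := proj1_sig (constructive_indefinite_description _
                         (strengthening_exists B δ)).
have pP δ : strengthening B δ (p δ) by apply: proj2_sig.
exists (fun δ => (p δ).1), (fun δ => (p δ).2) => K N U _.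
have strengthen H : graded_sub H U ->
    (forall i, collapse_free (H i) ((p (dimseq U)).2 i)) -> _ :=
  pP (dimseq U) K N U H erefl.
split=> [|H sHU freeH]; last by apply: strengthen => // i; apply/smin_geP.
(* The unconditional half is the case [H = 0], which is vacuously collapse-free. *)
have [i|i F|V [strV UV dimV _]] := strengthen (fun=> 0%VS).
- exact: sub0v.
- by rewrite memv0 => ->.
by exists V.
Qed.
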